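(* Let $\kappa\ge1$ and let $\mathcal I$ be an adversarial instance that admits a $\kappa$-imbalanced pair $(\mathcal U,\mathcal O)$. Then there exists a delayed algorithm that takes $(\mathcal U,\mathcal O)$ as input and satisfies $\mathbb E[\mathrm{ALG}(\mathcal I,\sigma)]\ge\frac{\kappa}{1+\kappa}\,\mathrm{OFF\text{-}I}(\mathcal I)$ for every arrival sequence $\sigma$.
   Context: Adversarial online matching with stochastic rewards. An instance $\mathcal I$ consists of a finite set $S$ of supply nodes, demand nodes $t\in[T]$, an edge set $E\subseteq S\times[T]$ with every $t$ having at least one neighbor, and a common consumption probability $\mu\in(0,1]$; $N(t)=\{u:(u,t)\in E\}$. Demand nodes arrive one per period in an adversarial order $\sigma$; upon arrival of $t$ the algorithm sees $N(t)$ and irrevocably matches $t$ to some $u\in N(t)$ or leaves it unmatched. If matched to $u$, independently with probability $\mu$ $t$ chooses to consume $u$, and $u$ is consumed if it has not been consumed before. The value is the number of consumed supply nodes, $\mathbb E[\mathrm{ALG}(\mathcal I,\sigma)]$ its expectation. A delayed algorithm's decision at period $t$ may depend on its random seed, the arrivals so far and its own previous matching decisions, but not on consumption outcomes. $\mathrm{OFF\text{-}I}(\mathcal I)$ is the optimal value of the LP: maximize $\sum_{(u,t)\in E}\mu x_{u,t}$ s.t. $\sum_{t:(u,t)\in E}\mu x_{u,t}\le1$ for all $u\in S$, $\sum_{u:(u,t)\in E}x_{u,t}\le1$ for all $t$, $x\ge0$. For $\kappa\ge1$, a pair $(\mathcal U,\mathcal O)$ is a $\kappa$-imbalanced pair if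 (i) $\mathcal U,\mathcal O$ are disjoint with $\mathcal U\cup\mathcal O=S$; (ii) $\mathrm{OFF\text{-}I}(\mathcal I)+(\kappa-1)|\mathcal U|$ equals the optimal value of the LP: maximize $\sum_{(u,t)\in E}\mu x_{u,t}$ s.t. $\sum_{t:(u,t)\in E}\mu x_{u,t}\le\kappa$ for $u\in\mathcal U$, $\sum_{t:(u,t)\in E}\mu x_{u,t}\le1$ for $u\in\mathcal O$, $\sum_{u:(u,t)\in E}x_{u,t}\le1$ for all $t$, $x\ge0$; (iii) there is an optimal solution $x^*$ of the LP defining $\mathrm{OFF\text{-}I}(\mathcal I)$ with $\mu\sum_{t:(u,t)\in E}x^*_{u,t}\le1/\kappa$ for all $u\in\mathcal O$. *)

(* Defs.v *)
From HB Require Import structures.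
From mathcomp Require Import all_boot all_order all_algebra all_fingroup.
From mathcomp Require Import all_classical all_reals all_analysis.

Set Implicit Arguments.
Unset Strict Implicit.
Unset Printing Implicit Defensive.

Import Order.TTheory GRing.Theory Num.Theory.

Local Open Scope ring_scope.

Record instance (R : realType) (S : finType) := Instance {
  horizon : nat;
  edge : S -> 'I_horizon -> bool;
  mu : R;
  edge_neighbor : forall t, exists u, edge u t;
  mu_gt0 : 0 < mu;
  mu_le1 : mu <= 1 }.

Arguments edge {R S} i u t.

Definition neighbors (R : realType) (S : finType) (I : instance R S)
  (t : 'I_(horizon I)) : {set S} := [set u | edge I u t]%SET.

Section LinearProgram.
Variables (R : realType) (S : finType) (I : instance R S).

(* Only the values of x on edges matter. *)
Definition lp_objective (x : S -> 'I_(horizon I) -> R) : R :=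
  \sum_(u : S) \sum_(t | edge I u t) mu I * x u t.

Definition lp_feasible (cap : S -> R) (x : S -> 'I_(horizon I) -> R) : Prop :=
  [/\ forall u, \sum_(t | edge I u t) mu I * x u t <= cap u,
      forall t, \sum_(u | edge I u t) x u t <= 1
    & forall u t, edge I u t -> 0 <= x u t].

Definition lp_value (cap : S -> R) : R :=
  sup [set lp_objective x | x in [set x | lp_feasible cap x]]%classic.

Definition lp_optimal (cap : S -> R) (x : S -> 'I_(horizon I) -> R) : Prop :=
  lp_feasible cap x /\
  forall y, lp_feasible cap y -> lp_objective y <= lp_objective x.

Definition OFF_I : R := lp_value (fun=> 1).

Definition imbalanced_pair (kappa : R) (U O : {set S}) : Prop :=
  [/\ [disjoint U & O] /\ U :|: O = finset.setT,
      OFF_I + (kappa - 1) * #|U|%:R =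
        lp_value (fun u => if u \in U then kappa else 1)
    & exists2 x, lp_optimal (fun=> 1) x &
        forall u, u \in O -> mu I * (\sum_(t | edge I u t) x u t) <= kappa^-1].

End LinearProgram.

(* In [decide w past N], w is the random seed, N the neighborhood of the
   arriving demand node, and past lists, oldest first, the neighborhoods of the
   earlier arrivals with the decisions taken then ([None]: left unmatched).
   Consumption outcomes are not an argument: the algorithm is delayed.
   [decide_measurable] is measurability in the seed, the finite type option S
   carrying its discrete sigma-algebra. *)
Record delayed_algorithm (R : realType) (S : finType) := DelayedAlgorithm {
  seed_display : measure_display;
  seed : measurableType seed_display;
  seed_law : probability seed R;
  decide : seed -> seq ({set S} * option S) -> {set S} -> option S;
  decide_neighbor : forall w past (N : {set S}) u,
    decide w past N = Some u -> u \in N;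
  decide_measurable : forall past N o,
    measurable [set w | decide w past N = o]%classic }.

Section Execution.
Variables (R : realType) (S : finType) (A : delayed_algorithm R S).

Fixpoint decisions (w : seed A) (past : seq ({set S} * option S))
    (arrivals : seq {set S}) : seq (option S) :=
  if arrivals is N :: arrivals' then
    let o := decide w past N in
    o :: decisions w (rcons past (N, o)) arrivals'
  else [::].

(* Each period is a decision paired with whether the demand node would consume
   the supply node offered to it; C is the set consumed so far. *)
Fixpoint consume (C : {set S}) (periods : seq (option S * bool)) : {set S} :=
  match periods with
  | [::] => C
  | (Some u, true) :: periods' => consume (u |: C) periods'
  | _ :: periods' => consume C periods'
  end.

Variable I : instance R S.

(* sigma i is the demand node arriving in period i. *)
Definition arrival_seq (sigma : {perm 'I_(horizon I)}) : seq 'I_(horizon I) :=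
  [seq sigma i | i <- enum 'I_(horizon I)].

(* c t tells whether demand node t chooses to consume. *)
Definition alg_value (sigma : {perm 'I_(horizon I)}) (w : seed A)
    (c : {ffun 'I_(horizon I) -> bool}) : nat :=
  let ts := arrival_seq sigma in
  #|consume finset.set0
      (zip (decisions w [::] [seq neighbors t | t <- ts]) [seq c t | t <- ts])|.

Definition choice_prob (c : {ffun 'I_(horizon I) -> bool}) : R :=
  \prod_t (if c t then mu I else 1 - mu I).

(* The choices c are independent of the seed, hence the iterated expectation. *)
Definition expected_alg (sigma : {perm 'I_(horizon I)}) : \bar R :=
  'E_(seed_law A)[fun w : seed A =>
     \sum_(c : {ffun 'I_(horizon I) -> bool})
        choice_prob c * (alg_value sigma w c)%:R].

End Execution.

(* Main.v *)
(** The algorithm is the deterministic greedy one that offers to t the neighbor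
    u maximizing w_u (1 - mu)^(number of earlier offers of u), with weight
    w_u = 1 on U and w_u = kappa on O. Write q_u for the final value of
    (1 - mu)^(offers of u), so that the expected value is sum_u (1 - q_u). The
    score of the chosen node dominates w_u q_u for every neighbor u of t, hence
    any z with at most one unit per demand node satisfies
      sum_u load_z(u) w_u q_u <= sum_u w_u (1 - q_u).
    If z has load (almost) kappa on U, and on O loads at most 1/kappa of total
    OFF-I - |U|, this inequality is the claim. For kappa > 1 such a z exists:
    every optimal x has load 1 on U, so the x of condition (iii) serves N(O)
    completely and only from O; hence the solutions of the augmented program
    must load U from outside N(O), and x on O combines with them on U. For
    kappa = 1 the optimal x itself does. *)

Require Import Defs.
From HB Require Import structures.
From mathcomp Require Import all_boot all_order all_algebra all_fingroup.
From mathcomp Require Import all_classical all_reals all_analysis.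
From mathcomp Require Import ring lra.

Set Implicit Arguments.
Unset Strict Implicit.
Unset Printing Implicit Defensive.

Import Order.TTheory GRing.Theory Num.Theory.

Local Open Scope ring_scope.

(** * The weighted greedy algorithm *)

Section WeightedGreedy.
Variables (R : realType) (S : finType).

Definition past_load (past : seq ({set S} * option S)) (u : S) : nat :=
  count_mem (Some u) [seq d.2 | d <- past].

Definition greedy_score (m : R) (weight : S -> R)
    (past : seq ({set S} * option S)) (u : S) : R :=
  weight u * (1 - m) ^+ past_load past u.

(** The picked node is only the base point that [arg max] requires; [None] arises for an empty
    neighborhood alone. The seed lives in [unit], as the rule is deterministic. *)
Definition greedy_decide (m : R) (weight : S -> R) (_ : unit)
    (past : seq ({set S} * option S)) (N : {set S}) : option S :=
  if [pick u in N] is Some u0 then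
    Some [arg max_(u > u0 in N) greedy_score m weight past u]%O
  else None.

Lemma greedy_decide_neighbor m weight w past N u :
  greedy_decide m weight w past N = Some u -> u \in N.
Proof.
rewrite /greedy_decide; case: pickP => // u0 Nu0 [<-].
by case: arg_maxP.
Qed.

Lemma greedy_decide_measurable m weight past N o :
  measurable [set w | greedy_decide m weight w past N = o]%classic.
Proof. by []. Qed.

Lemma greedy_decide_max m weight w past (N : {set S}) : (exists u, u \in N) ->
  exists2 v, greedy_decide m weight w past N = Some v &
    forall u, u \in N ->
      greedy_score m weight past u <= greedy_score m weight past v.
Proof.
move=> [u1 Nu1]; rewrite /greedy_decide; case: pickP => [u0 Nu0|/(_ u1)].
  by case: arg_maxP => // v Nv vmax; exists v.
by rewrite Nu1.
Qed.

Definition greedy (m : R) (weight : S -> R) : delayed_algorithm R S :=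
  @DelayedAlgorithm R S _ unit (\d_tt : probability unit R)
    (greedy_decide m weight)
    (@greedy_decide_neighbor m weight) (@greedy_decide_measurable m weight).

End WeightedGreedy.

(** * Expected value of an execution and the greedy inequality *)

Section Execution.
Variables (R : realType) (S : finType) (I : instance R S).

Lemma size_decisions (A : delayed_algorithm R S) w past arrivals :
  size (@decisions R S A w past arrivals) = size arrivals.
Proof. by elim: arrivals past => //= N arrivals IH past; rewrite IH. Qed.

Lemma mem_consume (C : {set S}) periods u :
  (u \in consume C periods) = (u \in C) || ((Some u, true) \in periods).
Proof.
elim: periods C => [|[[v|] [|]] periods IH] C /=; rewrite ?orbF ?IH // in_cons.
- rewrite in_setU1 orbA; congr (_ || _).
  by rewrite orbC; congr (_ || _); rewrite xpair_eqE andbT.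
- by rewrite xpair_eqE andbF.
Qed.

(** The indicator is a product over demand nodes, so the sum of products factors into a product of
    sums: a node of [P] contributes [1 - mu I], any other node 1. *)
Lemma sum_choice_prob_avoid (P : pred 'I_(horizon I)) :
  \sum_(c : {ffun 'I_(horizon I) -> bool})
      choice_prob c * [forall t, P t ==> ~~ c t]%:R =
    (1 - mu I) ^+ #|P|.
Proof.
pose F (t : 'I_(horizon I)) (b : bool) : R :=
  (if b then mu I else 1 - mu I) * (P t ==> ~~ b)%:R.
transitivity (\sum_(c : {ffun 'I_(horizon I) -> bool}) \prod_t F t (c t)).
  apply: eq_bigr => c _; rewrite big_split /=; congr (_ * _).
  case: forallP => [h|/forallP].
    by rewrite big1 // => t _; rewrite h.
  by rewrite negb_forall => /existsP[t /negbTE h]; rewrite (bigD1 t) //= h mul0r.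
rewrite -(bigA_distr_bigA F) -prodr_const [RHS]big_mkcond.
apply: eq_bigr => t _; rewrite big_bool /F /= implybT implybF unfold_in.
by case: (P t) => /=; ring.
Qed.

Lemma sum_choice_prob :
  \sum_(c : {ffun 'I_(horizon I) -> bool}) choice_prob c = 1.
Proof.
rewrite -[RHS](expr0 (1 - mu I)) -(card0 'I_(horizon I)).
rewrite -sum_choice_prob_avoid; apply: eq_bigr => c _.
by case: forallP => [_|h]; [rewrite mulr1|case: h].
Qed.

(** Decisions ignore [c], so [u] stays unconsumed exactly when every demand node it was offered to
    declines; linearity then sums over [u]. *)
Lemma sum_choice_prob_alg_value (A : delayed_algorithm R S) sigma w :
  \sum_(c : {ffun 'I_(horizon I) -> bool})
      choice_prob c * (@alg_value R S A I sigma w c)%:R =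
  \sum_u (1 - (1 - mu I) ^+ count_mem (Some u)
    (@decisions R S A w [::] [seq neighbors t | t <- arrival_seq sigma])).
Proof.
set ts := arrival_seq sigma; set ds := decisions _ _ _.
have uts : uniq ts by rewrite map_inj_uniq ?enum_uniq //; apply: perm_inj.
have tsT t : t \in ts.
  by rewrite -[t](permKV sigma) map_f // mem_enum.
have sds : size ds = size ts by rewrite size_decisions size_map.
(* The decision taken for [t]. Every demand node occurs in [ts], so the default [None] is never
   reached. *)
pose D t := nth None ds (index t ts).
have dsE : ds = map D ts.
  apply: (@eq_from_nth _ None); first by rewrite size_map.
  move=> i; rewrite sds => lti.
  have t0 : 'I_(horizon I) by case: (ts) lti.
  by rewrite (nth_map t0) // /D index_uniq.
under eq_bigr => c _.
  rewrite /alg_value -/ts -/ds -sum1_card natr_sum big_mkcond /= mulr_sumr.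
over.
rewrite exchange_big /=; apply: eq_bigr => u _.
rewrite dsE count_map.
have -> : count (preim D (pred1 (Some u))) ts = #|[pred t | D t == Some u]|.
  rewrite cardE -size_filter; apply/perm_size/uniq_perm.
  - by rewrite filter_uniq.
  - exact: enum_uniq.
  by move=> t; rewrite mem_filter tsT andbT mem_enum.
rewrite -sum_choice_prob_avoid -[X in _ = X - _]sum_choice_prob -sumrB.
apply: eq_bigr => c _; rewrite -[X in _ = X - _]mulr1 -mulrBr; congr (_ * _).
rewrite mem_consume inE /= zip_map.
case: forallP => [h|/forallP].
  rewrite /= mulr1n subrr ifF //; apply/negbTE/negP => /mapP[t _ [/esym Dt ct]].
  by have := h t; rewrite /= Dt eqxx -ct.
rewrite negb_forall => /existsP[t]; rewrite /= negb_imply negbK => /andP[/eqP Dt ct].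
by rewrite /= mulr0n subr0 ifT //; apply/mapP; exists t; rewrite // Dt ct.
Qed.

(* The bound M is instantiated by the score of the node chosen at t; by
   antitonicity of the scores it dominates the final ones. *)
Lemma greedy_gain (weight : S -> R) (v : 'I_(horizon I) -> R) w past ts
    (q : S -> R) :
  (forall u, 0 <= weight u) ->
  (forall u, q u = (1 - mu I) ^+ (past_load past u + count_mem (Some u)
     (@decisions R S (greedy (mu I) weight) w past
        [seq neighbors t | t <- ts]))) ->
  (forall t M, 0 <= M -> (forall u, edge I u t -> weight u * q u <= M) ->
     v t <= mu I * M) ->
  \sum_(t <- ts) v t <=
  \sum_u weight u * ((1 - mu I) ^+ past_load past u - q u).
Proof.
move=> wt0 + vM; have m0 := mu_gt0 I; have m1 := mu_le1 I.
elim: ts past => [|t ts IH] past qE.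
  rewrite big_nil big1 // => u _; by rewrite qE /= addn0 subrr mulr0.
rewrite big_cons.
have [|v0 dv0 v0max] := @greedy_decide_max _ S (mu I) weight w past (neighbors t).
  by case: (edge_neighbor t) => u eut; exists u; rewrite inE.
have gain : v t <= mu I * greedy_score (mu I) weight past v0.
  apply: vM.
    by rewrite mulr_ge0 // exprn_ge0 // subr_ge0.
  move=> u eut; apply: le_trans (v0max u _); last by rewrite inE.
  rewrite ler_wpM2l // qE exprD ler_piMr ?exprn_ge0 ?subr_ge0 //.
  by rewrite exprn_ile1 ?subr_ge0 // lerBlDl lerDr ltW.
have loadE u : past_load (rcons past (neighbors t, Some v0)) u =
    (past_load past u + (u == v0))%N.
  rewrite /past_load map_rcons -cats1 count_cat /= addn0; congr (_ + _)%N.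
  by rewrite eq_sym.
have /IH : forall u, q u = (1 - mu I) ^+
    (past_load (rcons past (neighbors t, Some v0)) u + count_mem (Some u)
      (@decisions R S (greedy (mu I) weight) w
         (rcons past (neighbors t, Some v0)) [seq neighbors t | t <- ts])).
  move=> u; rewrite qE /= dv0 loadE /= -addnA; congr (_ ^+ (_ + (_ + _))%N).
  by rewrite eq_sym.
(* One more offer multiplies the factor of [v0] by [1 - mu I], so the right-hand sum drops by
   exactly [mu I] times the score of [v0]. *)
rewrite (_ : (\sum_u weight u * (_ - q u)) =
    \sum_u weight u * ((1 - mu I) ^+ past_load past u - q u)
      - mu I * greedy_score (mu I) weight past v0); last first.
  rewrite [in RHS](bigD1 v0) //= [in LHS](bigD1 v0) //= loadE eqxx addn1 exprS.
  rewrite (_ : \sum_(i | i != v0) _ = \sum_(i | i != v0)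
    weight i * ((1 - mu I) ^+ past_load past i - q i)).
    by rewrite /greedy_score; ring.
  by apply: eq_bigr => u /negbTE nu; rewrite loadE nu addn0.
by rewrite lerBrDr addrC; apply: le_trans; rewrite lerD2r.
Qed.

End Execution.

(** * Loads, truncation and perturbation in the linear program *)

Section LinearProgram.
Variables (R : realType) (S : finType) (I : instance R S).
Implicit Types (x y z : S -> 'I_(horizon I) -> R) (cap : S -> R).

Definition load z (u : S) : R := \sum_(t | edge I u t) mu I * z u t.

Definition demand_feasible z : Prop :=
  (forall t, \sum_(u | edge I u t) z u t <= 1) /\
  (forall u t, edge I u t -> 0 <= z u t).

Lemma load_ge0 z u : demand_feasible z -> 0 <= load z u.
Proof.
by move=> [_ z0]; apply: sumr_ge0 => t eut; rewrite mulr_ge0 ?z0 // ltW // mu_gt0.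
Qed.

Lemma sum_load z (P : pred S) :
  \sum_(u | P u) load z u = \sum_t \sum_(u | P u && edge I u t) mu I * z u t.
Proof.
by rewrite /load (exchange_big_dep predT).
Qed.

Lemma lp_feasible_demand cap z : lp_feasible cap z -> demand_feasible z.
Proof. by case. Qed.

Lemma lp_objective_le_value cap z :
  lp_feasible cap z -> lp_objective z <= lp_value I cap.
Proof.
move=> fz; apply: ub_le_sup; last by exists z.
by exists (\sum_u cap u) => _ [y [fy _ _] <-]; apply: ler_sum => u _.
Qed.

Lemma lp_value_optimal cap z : lp_optimal cap z -> lp_value I cap = lp_objective z.
Proof.
move=> [fz zmax]; apply/eqP; rewrite eq_le lp_objective_le_value // andbT.
apply: ge_sup; first by exists (lp_objective z), z.
by move=> _ [y fy <-]; apply: zmax.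
Qed.

(** [lp_value] is a supremum, nonempty by the zero solution and bounded by the total capacity;
    near-optimal solutions stand in for an attained optimum. *)
Lemma lp_near_optimal cap e : (forall u, 0 <= cap u) -> 0 < e ->
  exists2 y, lp_feasible cap y & lp_value I cap - e < @lp_objective R S I y.
Proof.
move=> cap0 e0.
have [|_ [y fy <-] lty] := @sup_adherent R
  [set @lp_objective R S I x | x in [set x | @lp_feasible R S I cap x]]%classic e e0.
  split; last first.
    by exists (\sum_u cap u) => _ [y [fy _ _] <-]; apply: ler_sum => u _.
  exists (lp_objective (fun _ (_ : 'I_(horizon I)) => 0)), (fun _ _ => 0) => //.
  split=> // [u|t]; rewrite big1 // => ? _; exact: mulr0.
by exists y.
Qed.

(** Scaling the row of each overloaded supply node down to load 1 only lowers the demand sums, so it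
    yields a feasible solution whose objective is the left-hand side. *)
Lemma sum_truncated_load_le z :
  demand_feasible z -> \sum_u Num.min (load z u) 1 <= OFF_I I.
Proof.
move=> fz; case: (fz) => rz z0.
pose c u := if load z u <= 1 then 1 else (load z u)^-1.
have c01 u : 0 <= c u <= 1.
  rewrite /c; case: (leP (load z u) 1) => h; first by rewrite ler01 lexx.
  by rewrite invr_ge0 invf_le1 ?(ltW h) ?load_ge0 // (lt_trans ltr01).
pose z' u t := z u t * c u.
have lz' u : load z' u = Num.min (load z u) 1.
  rewrite /load; under eq_bigr do rewrite mulrA.
  rewrite -mulr_suml -/(load z u) /c; case: (leP (load z u) 1) => h; first by rewrite mulr1.
  by rewrite mulfV // gt_eqF // (lt_trans ltr01).
under eq_bigr do rewrite -lz'.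
apply: lp_objective_le_value; split.
- by move=> u; rewrite -/(load z' u) lz' ge_min lexx orbT.
- move=> t; apply: le_trans (rz t); apply: ler_sum => u eut.
  by case/andP: (c01 u) => ? ?; rewrite ler_piMr // z0.
- by move=> u t eut; case/andP: (c01 u) => ? ?; rewrite mulr_ge0 // z0.
Qed.

(** Perturbation on one edge; two opposite ones at the same demand node shift its service between
    supply nodes. *)
Definition bump z u0 t0 e u t : R :=
  z u t + (if (u == u0) && (t == t0) then e else 0).

Lemma load_bump z u0 t0 e u : edge I u0 t0 ->
  load (bump z u0 t0 e) u = load z u + (if u == u0 then mu I * e else 0).
Proof.
move=> e0; rewrite /load /bump; under eq_bigr do rewrite mulrDr.
rewrite big_split /=; congr (_ + _); case: eqP => [->|_] /=.
  rewrite (bigD1 t0) //= eqxx big1 ?addr0 // => t /andP[_ /negbTE ->].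
  exact: mulr0.
by rewrite big1 // => t _; rewrite mulr0.
Qed.

Lemma demand_bump z u0 t0 e t : edge I u0 t0 ->
  \sum_(u | edge I u t) bump z u0 t0 e u t =
  \sum_(u | edge I u t) z u t + (if t == t0 then e else 0).
Proof.
move=> e0; rewrite /bump big_split /=; congr (_ + _).
case: eqP => [->|_] /=.
  rewrite (bigD1 u0) //= eqxx big1 ?addr0 // => u /andP[_ /negbTE ->] //.
by rewrite big1 // => u _; rewrite andbF.
Qed.

Lemma objective_bump z u0 t0 e : edge I u0 t0 ->
  lp_objective (bump z u0 t0 e) = lp_objective z + mu I * e.
Proof.
move=> e0; rewrite /lp_objective.
under eq_bigr => u _ do rewrite -/(load (bump z u0 t0 e) u) load_bump //.
by rewrite big_split /= -big_mkcond big_pred1_eq.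
Qed.

End LinearProgram.

(** * Structure of imbalanced pairs and the greedy bound for kappa > 1 *)

Section ImbalancedPair.
Variables (R : realType) (S : finType) (I : instance R S).
Variables (kappa : R) (U O : {set S}).
Hypothesis kappa_gt1 : 1 < kappa.
Hypothesis UO : forall u, (u \in O) = (u \notin U).
Hypothesis augmented_value : OFF_I I + (kappa - 1) * #|U|%:R =
  lp_value I (fun u => if u \in U then kappa else 1).

Lemma augmented_near_optimal e : 0 < e ->
  exists2 y, @lp_feasible R S I (fun u => if u \in U then kappa else 1) y &
    OFF_I I + (kappa - 1) * #|U|%:R - e < @lp_objective R S I y.
Proof.
move=> e0; rewrite augmented_value; apply: lp_near_optimal => // u.
by have := kappa_gt1; case: ifP => _; lra.
Qed.

(* Otherwise, moving x slightly towards a near-optimal solution of the augmented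
   program and truncating the loads at 1 would beat x: the truncation loses
   nothing at a node of U that has slack. *)
Lemma optimal_load_U x u :
  @lp_optimal R S I (fun=> 1) x -> u \in U -> load x u = 1.
Proof.
move=> ox uU; have OFFx := lp_value_optimal ox; case: (ox) => [[lx rx x0] _].
apply/eqP; rewrite eq_le lx /= leNgt; apply/negP => ltu.
(* Sparing [u] the truncation will gain [l * (kappa - 1)], while near-optimality costs at most [l]
   times the tolerance; half of [kappa - 1] leaves a strict surplus. *)
have [|y [ly ry y0] hy] := @augmented_near_optimal ((kappa - 1) / 2).
  by have := kappa_gt1; lra.
have k1 := kappa_gt1.
pose e := 1 - load x u; have e0 : 0 < e by rewrite subr_gt0.
(* Small enough that [(1 - l) * (1 - e) + l * kappa <= 1], so the load of [u] in [z] needs no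
   truncation. *)
pose l := e / (e + kappa).
have ek : 0 < e + kappa by lra.
have lE : l * (e + kappa) = e by rewrite /l divfK // gt_eqF.
have l0 : 0 < l by rewrite divr_gt0.
have l1 : l < 1 by rewrite /l ltr_pdivrMr //; lra.
pose z v t := (1 - l) * x v t + l * y v t.
have lz v : load z v = (1 - l) * load x v + l * load y v.
  rewrite /load !mulr_sumr -big_split /=; apply: eq_bigr => t _.
  by rewrite /z; ring.
have fz : demand_feasible z.
  split=> [t|v t evt].
    rewrite /z big_split /= -!mulr_sumr.
    have : (1 - l) * \sum_(i | edge I i t) x i t <= (1 - l) * 1.
      by rewrite ler_wpM2l // subr_ge0 ltW.
    have : l * \sum_(i | edge I i t) y i t <= l * 1 by rewrite ler_wpM2l // ltW.
    lra.
  by rewrite addr_ge0 // mulr_ge0 ?x0 ?y0 ?subr_ge0 // ltW.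
(* Loads in [z] are at most [1 + d] on [U] and at most 1 elsewhere, so truncation costs at most [d],
   and only on [U]. *)
pose d := l * (kappa - 1).
have d0 : 0 < d by rewrite mulr_gt0 // subr_gt0.
have : \sum_v (load z v - (if v \in U then d else 0) +
    (if v == u then d else 0)) <= OFF_I I.
  apply: le_trans (sum_truncated_load_le fz); apply: ler_sum => v _.
  have hx : (1 - l) * load x v <= (1 - l) * 1.
    by rewrite ler_wpM2l ?lx // subr_ge0 ltW.
  have hy' : l * load y v <= l * (if v \in U then kappa else 1).
    by rewrite ler_wpM2l ?ly // ltW.
  have hlz := lz v.
  rewrite le_min; case: (eqVneq v u) => [vu|_].
    subst v; move: hy' hlz; rewrite uU addrNK lexx /= => hy' ->.
    have -> : load x u = 1 - e by rewrite /e; ring.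
    lra.
  by move: hy' d0; rewrite /d; case: ifP => _ hy' d0; apply/andP; split; lra.
rewrite big_split /= sumrB -!big_mkcond /= big_pred1_eq sumr_const.
under eq_bigr do rewrite lz.
rewrite big_split /= -!mulr_sumr.
rewrite -/(lp_objective x) -/(lp_objective y) -OFFx -/(OFF_I I) -mulr_natr.
have := ltr_pM2l l0; move/(_ (OFF_I I + (kappa - 1) * #|U|%:R - (kappa - 1) / 2) (lp_objective y)).
rewrite hy => hly; move: d0; rewrite /d => d0; lra.
Qed.

(** Node [o] has slack at least [1 - kappa^-1]. If [t] were not fully served, more service from [o]
    would improve [x]; if [t] were served from [U], moving some of it to [o] would keep optimality
    but leave a node of [U] below load 1. *)
Lemma optimal_demand_O x t o :
  @lp_optimal R S I (fun=> 1) x ->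
  (forall u, u \in O -> load x u <= kappa^-1) ->
  o \in O -> edge I o t ->
  \sum_(u | (u \in O) && edge I u t) x u t = 1.
Proof.
move=> ox xO oO eot; case: (ox) => [[lx rx x0] xmax].
have m0 := mu_gt0 I; have k1 := kappa_gt1.
have kV : kappa^-1 < 1 by rewrite invf_lt1 // (lt_trans ltr01).
have s0 : 0 < (1 - kappa^-1) / mu I by rewrite divr_gt0 // subr_gt0.
have step e : e <= (1 - kappa^-1) / mu I -> mu I * e <= 1 - kappa^-1.
  by move=> le; rewrite mulrC -ler_pdivlMr.
have full : \sum_(u | edge I u t) x u t = 1.
  apply/eqP; rewrite eq_le rx /= leNgt; apply/negP => lt1.
  pose e := Num.min (1 - \sum_(u | edge I u t) x u t) ((1 - kappa^-1) / mu I).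
  have e0 : 0 < e by rewrite lt_min subr_gt0 lt1.
  have /xmax : lp_feasible (fun=> 1) (bump x o t e).
    split=> [u|s|u s eus].
    - rewrite -/(load (bump x o t e) u) load_bump //.
      case: eqP => [->|_]; last by rewrite addr0; apply: lx.
      have := step e; rewrite ge_min lexx orbT => /(_ isT).
      by have := xO o oO; lra.
    - rewrite demand_bump //; case: eqP => [->|_]; last by rewrite addr0.
      by rewrite -lerBrDl ge_min lexx.
    - by rewrite /bump; case: ifP => _; rewrite addr_ge0 ?x0 // ltW.
  by rewrite objective_bump // gerDl leNgt mulr_gt0.
have zero u : u \in U -> edge I u t -> x u t = 0.
  move=> uU eut; apply/eqP; rewrite eq_le x0 // andbT leNgt; apply/negP => xut0.
  pose e := Num.min (x u t) ((1 - kappa^-1) / mu I).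
  have e0 : 0 < e by rewrite lt_min xut0.
  have uo : (u == o) = false by apply: contraTF uU => /eqP ->; rewrite -UO.
  pose x' := bump (bump x o t e) u t (- e).
  have lx' v : load x' v = load x v + (if v == o then mu I * e else 0) +
      (if v == u then mu I * - e else 0) by rewrite !load_bump.
  (* The two bumps cancel in the objective, so [x'] inherits optimality once it is feasible. *)
  have ox' : lp_optimal (fun=> 1) x'.
    split; last by move=> z /xmax; rewrite !objective_bump // mulrN addrK.
    split=> [v|s|v s evs].
    - rewrite -/(load x' v) lx'; have := lx v; rewrite -/(load x v) => lxv.
      case: eqP => [->|_].
        rewrite eq_sym uo addr0.
        have := step e; rewrite ge_min lexx orbT => /(_ isT).
        by have := xO o oO; lra.
      by case: eqP => _; have := mulr_gt0 m0 e0; lra.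
    - rewrite !demand_bump //; have := rx s; case: eqP => _; lra.
    - rewrite /x' /bump; have := x0 v s evs.
      case: (eqVneq v u) => [->|_] /=.
        rewrite uo /=; case: eqP => [->|_] xus; last by lra.
        by rewrite addr0 subr_ge0 ge_min lexx.
      by case: ifP => _; lra.
  have := optimal_load_U ox' uU.
  rewrite lx' uo eqxx addr0; have := lx u; rewrite -/(load x u).
  by have := mulr_gt0 m0 e0; lra.
rewrite -full [RHS](bigID (fun u => u \in O)) /= [X in _ + X]big1 ?addr0.
  by apply: eq_bigl => u; rewrite andbC.
by move=> u /andP[eut]; rewrite UO negbK => uU; apply: zero.
Qed.

Definition priority_weight (u : S) : R := if u \in U then 1 else kappa.

(* By [optimal_demand_O], x spends all of N(O) on O, so that a near-optimal
   solution y of the augmented program loads U almost fully from outside N(O);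
   z follows x on O and y on U and tests the greedy inequality. *)
Lemma greedy_bound_imbalanced x (q : S -> R) :
  @lp_optimal R S I (fun=> 1) x ->
  (forall u, u \in O -> load x u <= kappa^-1) ->
  (forall u, q u <= 1) ->
  (forall z, @demand_feasible R S I z ->
     \sum_u load z u * (priority_weight u * q u) <=
     \sum_u priority_weight u * (1 - q u)) ->
  kappa * OFF_I I <= (1 + kappa) * \sum_u (1 - q u).
Proof.
move=> ox xO q1 greedy_le; case: (ox) => [[lx rx x0] _].
have m0 := mu_gt0 I; have k1 := kappa_gt1; have k0 : 0 < kappa by lra.
(* The demand nodes in N(O). *)
pose B t := [exists u, (u \in O) && edge I u t].
have loadO : \sum_(u in O) load x u = \sum_(t | B t) mu I.
  rewrite sum_load [RHS]big_mkcond; apply: eq_bigr => t _.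
  case: ifP => [/existsP[v /andP[vO evt]]|nB].
    by rewrite -mulr_sumr (optimal_demand_O ox xO vO evt) mulr1.
  by rewrite big1 // => u h; move/existsP: nB; case; exists u.
have OFFE : OFF_I I = #|U|%:R + \sum_(u in O) load x u.
  rewrite /OFF_I (lp_value_optimal ox) /lp_objective (bigID (fun u => u \in U)) /=.
  congr (_ + _); last by apply: eq_bigl => u; rewrite UO.
  by rewrite -sumr_const; apply: eq_bigr => u uU; apply: optimal_load_U.
apply/ler_addgt0Pr => e e0.
have [y fy hy] := augmented_near_optimal e0; case: (fy) => ly ry y0.
pose z u t := if u \in U then if B t then 0 else y u t else x u t.
have fz : demand_feasible z.
  split=> [t|u t eut]; last by rewrite /z; case: ifP; [case: ifP|]; auto.
  case: (boolP (B t)) => Bt; last first.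
    apply: le_trans (ry t); apply: ler_sum => u eut; rewrite /z (negbTE Bt).
    case: ifP => // /negbT; rewrite -UO => uO; case/negP: Bt.
    by apply/existsP; exists u; rewrite uO.
  apply: le_trans (rx t); apply: ler_sum => u eut; rewrite /z Bt.
  by case: ifP => // _; apply: x0.
have lzU : \sum_(u in U) load z u = \sum_(t | ~~ B t) \sum_(u | edge I u t) mu I * y u t.
  rewrite sum_load [RHS]big_mkcond; apply: eq_bigr => t _; rewrite if_neg.
  case: ifP => Bt; first by rewrite big1 // => u /andP[uU _]; rewrite /z uU Bt mulr0.
  apply: eq_big => [u|u /andP[uU _]]; last by rewrite /z uU Bt.
  case: (boolP (u \in U)) => //=; rewrite -UO => uO; apply/esym/negbTE/negP => eut.
  by move/existsP: Bt; case; exists u; rewrite uO.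
(* On N(O), [y] earns at most [mu I] per demand node, which is the total load of [x] on [O]; the
   rest of its objective is the load of [z] on [U]. *)
have lzU_ge : kappa * #|U|%:R - e <= \sum_(u in U) load z u.
  have : lp_objective y <= \sum_(t | B t) mu I + \sum_(u in U) load z u.
    rewrite -[lp_objective y]/(\sum_u load y u) (sum_load y) lzU (bigID B) /= lerD2r.
    by apply: ler_sum => t _; rewrite -mulr_sumr ler_piMr // ltW.
  rewrite -loadO; move: hy; rewrite OFFE; lra.
have lzU_le u : u \in U -> load z u <= kappa.
  move=> uU; have := ly u; rewrite uU; apply: le_trans; apply: ler_sum => t eut.
  by rewrite ler_pM2l // /z uU; case: ifP => // _; apply: y0.
have lzO u : u \notin U -> load z u = load x u.
  by move=> /negbTE uU; apply: eq_bigr => t _; rewrite /z uU.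
have : \sum_u (if u \in U then load z u else kappa * load x u) <=
    (1 + kappa) * \sum_u (1 - q u).
  (* Splits [1 + kappa] into the weight and its complement. The greedy inequality pays for the first
     part, and the complement absorbs [1 - q u] nodewise, by load at most [kappa] on [U] and
     [kappa^-1] on [O]. *)
  have -> : (1 + kappa) * \sum_u (1 - q u) = \sum_u priority_weight u * (1 - q u)
      + \sum_u (if u \in U then kappa else 1) * (1 - q u).
    rewrite mulr_sumr -big_split; apply: eq_bigr => u _.
    by rewrite /priority_weight; case: ifP => _ /=; ring.
  rewrite -lerBlDr; apply: le_trans (greedy_le z fz); rewrite -sumrB.
  apply: ler_sum => u _; rewrite /priority_weight.
  have qu : 0 <= 1 - q u by rewrite subr_ge0.
  case: (boolP (u \in U)) => uU.
    have : 0 <= (kappa - load z u) * (1 - q u) by apply: mulr_ge0 => //; rewrite subr_ge0 lzU_le.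
    by lra.
  rewrite lzO //.
  have : 0 <= (1 - kappa * load x u) * (1 - q u).
    by apply: mulr_ge0 => //; rewrite subr_ge0 mulrC -ler_pdivlMr // mul1r xO // UO.
  by lra.
have -> : \sum_u (if u \in U then load z u else kappa * load x u) =
    \sum_(u in U) load z u + kappa * \sum_(u in O) load x u.
  rewrite (bigID (fun u => u \in U)) mulr_sumr /=; congr (_ + _).
    by apply: eq_bigr => u ->.
  by apply: eq_big => [u|u /negbTE ->] //; rewrite UO.
by rewrite OFFE; lra.
Qed.

End ImbalancedPair.

(** * The bound for kappa = 1 and the final assembly *)

Lemma greedy_bound_unweighted (R : realType) (S : finType) (I : instance R S)
    x (q : S -> R) :
  @lp_optimal R S I (fun=> 1) x -> (forall u, q u <= 1) ->
  \sum_u load x u * q u <= \sum_u (1 - q u) ->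
  OFF_I I <= 2 * \sum_u (1 - q u).
Proof.
move=> ox q1 greedy_le; case: (ox) => [[lx _ _] _].
rewrite /OFF_I (lp_value_optimal ox) mulr_natl mulr2n -lerBlDr.
apply: le_trans greedy_le; rewrite -sumrB; apply: ler_sum => u _.
have : 0 <= (1 - load x u) * (1 - q u) by rewrite mulr_ge0 // subr_ge0 ?lx.
by rewrite -/(load x u); lra.
Qed.

(** Regroups the left-hand side by arriving demand node. Each node's share is at most [mu I * M]
    because [z] gives it at most one unit, as [greedy_gain] requires from an empty past. *)
Lemma greedy_test (R : realType) (S : finType) (I : instance R S)
    (weight : S -> R) (sigma : {perm 'I_(horizon I)}) w (q : S -> R) z :
  (forall u, 0 <= weight u) ->
  (forall u, q u = (1 - mu I) ^+ count_mem (Some u)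
     (@decisions R S (greedy (mu I) weight) w [::]
        [seq neighbors t | t <- arrival_seq sigma])) ->
  @demand_feasible R S I z ->
  \sum_u load z u * (weight u * q u) <= \sum_u weight u * (1 - q u).
Proof.
move=> wt0 qE [rz z0]; have m0 := mu_gt0 I.
pose v (t : 'I_(horizon I)) := \sum_(u | edge I u t) mu I * z u t * (weight u * q u).
have -> : \sum_u load z u * (weight u * q u) = \sum_(t <- arrival_seq sigma) v t.
  rewrite big_map big_enum /=.
  transitivity (\sum_t v t); last exact: (reindex_inj (@perm_inj _ sigma)).
  rewrite /v; under eq_bigr do rewrite /load mulr_suml.
  by rewrite (exchange_big_dep predT).
apply: (greedy_gain (past := [::]) (w := w)) => // t M M0 wM.
apply: (@le_trans _ _ (mu I * M * \sum_(u | edge I u t) z u t)).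
  rewrite mulr_sumr; apply: ler_sum => u eut.
  rewrite mulrAC ler_wpM2r ?z0 // ler_pM2l //; exact: wM.
by rewrite ler_piMr // mulr_ge0 // ltW.
Qed.

Theorem theorem2 (R : realType) (kappa : R) (kappa_ge1 : 1 <= kappa)
    (S : finType) :
  exists alg : R -> {set S} -> {set S} -> delayed_algorithm R S,
  forall (I : instance R S) (U O : {set S}),
    imbalanced_pair I kappa U O ->
    forall sigma : {perm 'I_(horizon I)},
      ((kappa / (1 + kappa) * OFF_I I)%:E
        <= expected_alg (alg (mu I) U O) sigma)%E.
Proof.
exists (fun m U _ => greedy m (priority_weight kappa U)).
move=> I U O [[dUO cUO] augmented [x ox xO]] sigma.
have k0 : 0 < kappa by apply: lt_le_trans kappa_ge1.
have UO u : (u \in O) = (u \notin U).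
  have /finset.setP/(_ u) := cUO; rewrite !inE.
  by case: (boolP (u \in U)) => // /(disjointFr dUO).
set weight := priority_weight kappa U.
have wt0 u : 0 <= weight u by rewrite /weight /priority_weight; case: ifP => _; lra.
pose q u := (1 - mu I) ^+ count_mem (Some u)
  (@decisions R S (greedy (mu I) weight) tt [::]
     [seq neighbors t | t <- arrival_seq sigma]).
have -> : expected_alg (greedy (mu I) weight) sigma = (\sum_u (1 - q u))%:E.
  rewrite -[RHS](expectation_cst (\d_tt : probability unit R)) /expected_alg.
  by congr expectation; apply/funext => -[]; rewrite sum_choice_prob_alg_value.
rewrite lee_fin mulrAC ler_pdivrMr ?[_ * (1 + _)]mulrC; last by lra.
have q1 u : q u <= 1.
  by rewrite exprn_ile1 ?subr_ge0 ?mu_le1 // lerBlDl lerDr ltW // mu_gt0.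
have test z : @demand_feasible R S I z -> \sum_u load z u * (weight u * q u) <=
    \sum_u weight u * (1 - q u).
  exact: (@greedy_test _ _ _ _ sigma tt q z wt0 (fun=> erefl)).
have xO' u : u \in O -> load x u <= kappa^-1.
  by move=> /xO; rewrite mulr_sumr.
(* The structural lemmas rest on the strict slack [1 - kappa^-1 > 0]; at kappa = 1 all weights are 1
   and [x] itself is the test solution. *)
move: kappa_ge1; rewrite le_eqVlt => /predU1P[k1|k1].
  have w1 u : weight u = 1 by rewrite /weight /priority_weight -k1 if_same.
  rewrite -k1 mul1r; apply: (greedy_bound_unweighted ox q1).
  have := test x (lp_feasible_demand ox.1).
  by under eq_bigr do rewrite w1 mul1r; under [leRHS]eq_bigr do rewrite w1 mul1r.
by apply: (greedy_bound_imbalanced k1 UO augmented ox xO' q1 test).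
Qed.
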